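(* Let $\mathcal X$ be an antisymmetric cyclotomic scheme over a finite field. Then $gb(\mathcal X)\le 1$ and $b(\mathcal X)\le 3$.
   Context: A coherent configuration on a finite set $\Omega$ is a pair $\mathcal X=(\Omega,S)$ where $S$ is a partition of $\Omega\times\Omega$ such that $1_\Omega$ is a union of elements of $S$, $s^*=\{(\beta,\alpha):(\alpha,\beta)\in s\}\in S$ for $s\in S$, and for $r,s,t\in S$ the number $|\{\gamma:(\alpha,\gamma)\in r,(\gamma,\beta)\in s\}|$ is independent of $(\alpha,\beta)\in t$; fibers are sets $\Gamma$ with $1_\Gamma\in S$. It is antisymmetric if every $s\in S$ with $s=s^*$ lies in $1_\Omega$. A fission is a finer coherent configuration (its relation set, i.e. unions of basic relations, contains that of $\mathcal X$); complete means all basic relations are singletons. For $\Pi\subseteq 2^\Omega$ the $\Pi$-fission is the smallest fission in which every member of $\Pi$ is a union of fibers; $\Pi$ is a generalized base if the $\Pi$-fission is complete, and a set $B\subseteq\Omega$ is a base if $\{\{\beta\}:\beta\in B\}$ is a generalized base; $gb(\mathcal X)$, $b(\mathcal X)$ are the minimum sizes. For a finite field $\mathbb F$ and a subgroup $K$ of $\mathbb F^\times$, the cyclotomic scheme over $\mathbb F$ is $\mathrm{Inv}(G)$ with $G=\{x\mapsto ax+b: a\in K, b\in\mathbb F\}\le\mathrm{AGL}(1,\mathbb F)$, where $\mathrm{Inv}(G)=(\mathbb F,\text{orbits of }G\text{ on }\mathbb F\times\mathbb F)$. *)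

(* Defs.v *)
From mathcomp Require Import all_boot all_order all_algebra all_fingroup all_field.
Set Implicit Arguments. Unset Strict Implicit. Unset Printing Implicit Defensive.

Section CoherentConfigurations.
Variable T : finType.

Definition diagT : {set T * T} := [set p | p.1 == p.2].
Definition diag_on (G : {set T}) : {set T * T} :=
  [set p | (p.1 == p.2) && (p.1 \in G)].
Definition rtrans (s : {set T * T}) : {set T * T} := [set p | (p.2, p.1) \in s].

Definition is_union (S : {set {set T * T}}) (X : {set T * T}) : bool :=
  X == \bigcup_(s in S | s \subset X) s.

Definition inum (r s : {set T * T}) (p : T * T) : nat :=
  #|[set g | ((p.1, g) \in r) && ((g, p.2) \in s)]|.

Definition coherent (S : {set {set T * T}}) : bool :=
  [&& partition S [set: T * T],
      is_union S diagT,
      [forall s in S, rtrans s \in S] &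
      [forall r in S, forall s in S, forall t in S, forall p in t, forall q in t,
         inum r s p == inum r s q]].

Definition fibers (S : {set {set T * T}}) : {set {set T}} :=
  [set G : {set T} | diag_on G \in S].

Definition cc_antisymmetric (S : {set {set T * T}}) : bool :=
  [forall s in S, (rtrans s == s) ==> (s \subset diagT)].

Definition fission (S S' : {set {set T * T}}) : bool :=
  coherent S' && [forall s in S, is_union S' s].

Definition complete (S : {set {set T * T}}) : bool := [forall s in S, #|s| == 1].

Definition union_of_fibers (S : {set {set T * T}}) (D : {set T}) : bool :=
  D == \bigcup_(G in fibers S | G \subset D) G.

Definition pi_fission (S : {set {set T * T}}) (Pi : {set {set T}})
    (S' : {set {set T * T}}) : bool :=
  [&& fission S S', [forall D in Pi, union_of_fibers S' D] &
      [forall S'' : {set {set T * T}},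
         (fission S S'' && [forall D in Pi, union_of_fibers S'' D])
           ==> fission S' S'']].

Definition gen_base (S : {set {set T * T}}) (Pi : {set {set T}}) : bool :=
  [exists S' : {set {set T * T}}, pi_fission S Pi S' && complete S'].

Definition is_base (S : {set {set T * T}}) (B : {set T}) : bool :=
  gen_base S [set [set x] | x in B].

(* gb(X) and b(X): minimum sizes (default value only used if no
   (generalized) base exists, which never happens). *)
Definition gb (S : {set {set T * T}}) : nat :=
  \big[minn/#|{set {set T}}|.+1]_(Pi : {set {set T}} | gen_base S Pi) #|Pi|.

Definition bnum (S : {set {set T * T}}) : nat :=
  \big[minn/#|T|.+1]_(B : {set T} | is_base S B) #|B|.

End CoherentConfigurations.

(* Cyclotomic scheme over a finite field F for a subgroup K of F^x :
   Inv(G) with G = { x |-> a x + b : a in K, b in F }, i.e. the set of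
   orbits of G on F * F. *)
Section Cyclotomic.
Variable F : finFieldType.
Variable K : {group {unit F}}.
Local Open Scope ring_scope.

Definition affine_orbit (p : F * F) : {set F * F} :=
  [set ((val a) * p.1 + b, (val a) * p.2 + b) | a in K, b in [set: F]].

Definition cyclotomic_scheme : {set {set F * F}} :=
  [set affine_orbit p | p in [set: F * F]].

End Cyclotomic.

(* Main.v *)
Require Import Defs.
From mathcomp Require Import all_boot all_order all_algebra all_fingroup all_field.
From mathcomp Require Import cyclic pgroup zify ring.

(**
Write q = |F|, m = |K|. Antisymmetry means that -1 is not in K, so q and m are
odd and 2m <= q - 1. Let S be a fission in which 0, 1 and c are fibers. The
functions of x / y that are constant on the classes of S form a Schur ring over
the cyclic group F^*, closed under pointwise product and convolution. Its dual
is an equivalence relation on the exponents modulo q - 1 of the complex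
characters of F^*; class(a + b) is contained in class(a) + class(b).

The function (y / x - 1)^m with values in F is constant on the classes of S.
Reducing Gauss-type sums from Z[zeta] to F shows that exponents a with
(m choose a) nonzero in F are equivalent only to exponents of the same kind. If
j is equivalent to 1 and is not a power of the characteristic p, then j = a + b
with a, b > 0 and (m choose a), (m choose b) nonzero in F, so 1 = a' + b' for
some exponents 0 < a', b' <= m: a contradiction. (This replaces the degree
argument in McConnel's theorem on automorphisms of cyclotomic schemes.)

Hence the class I of 1 consists of powers of p, which form a Sidon set. With
E(t) the sum of chi^i(t) for i in I, the sum over w of
E(x/w) E(w/c) E(1/w) E(w/y) therefore isolates E(x/(cy)), so that E(x/(cy)) is
also constant on the classes of S. If c or -c generates F^*, this separates the
elements of I, so I = {1}, the injective function chi is constant on the classes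
of S, and S is complete. This gives b <= 3. For gb <= 1 the single set {0, 1, c}
is used, with the sign of c chosen so that the colored tournament induced on
this set is not a directed cycle, which splits it into singletons.
*)

Set Implicit Arguments.
Unset Strict Implicit.
Unset Printing Implicit Defensive.

Import GRing.Theory Num.Theory.
Local Open Scope ring_scope.

(** * Functions constant on basic relations *)

Section Adapted.
Variables (T : finType) (S : {set {set T * T}}).
Hypothesis cohS : coherent S.

(** With values in a ring, these are the matrices of the coherent algebra of [S]. The codomain is
    left free because values in [bool], [int], [algC] and [F] all occur. *)
Definition adapted (R : Type) (f : T * T -> R) :=
  forall s p q, s \in S -> p \in s -> q \in s -> f p = f q.

Lemma coherent_pblock p : pblock S p \in S.
Proof.
case/and4P: cohS => /and3P[/eqP covS _ _] _ _ _.
by rewrite pblock_mem ?covS ?inE.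
Qed.

Lemma coherent_pblock_id p : p \in pblock S p.
Proof.
case/and4P: cohS => /and3P[/eqP covS _ _] _ _ _.
by rewrite mem_pblock ?covS ?inE.
Qed.

Lemma coherent_blockE s p : s \in S -> (p \in s) = (pblock S p == s).
Proof.
case/and4P: cohS => /and3P[_ trivS _] _ _ _ sS.
apply/idP/eqP => [|<-]; last exact: coherent_pblock_id.
exact: def_pblock.
Qed.

Lemma adapted_comp (R R' : Type) (h : R -> R') f :
  adapted f -> adapted (fun p => h (f p)).
Proof. by move=> af s p q sS ps qs; rewrite (af s p q). Qed.

Lemma adapted_comp2 (R R' R'' : Type) (h : R -> R' -> R'') f g :
  adapted f -> adapted g -> adapted (fun p => h (f p) (g p)).
Proof. by move=> af ag s p q sS ps qs; rewrite (af s p q) // (ag s p q). Qed.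

Lemma adapted_swap (R : Type) (f : T * T -> R) :
  adapted f -> adapted (fun p => f (p.2, p.1)).
Proof.
case/and4P: cohS => _ _ /forall_inP trS _ af s p q sS ps qs.
by apply: (af (rtrans s)); rewrite ?trS ?inE //= -?surjective_pairing.
Qed.

(** Grouping the indices [z] by the classes of the two pairs they form turns the sum into a
    combination of intersection numbers. *)
Lemma adapted_mul (R : pzRingType) (f g : T * T -> R) :
  adapted f -> adapted g -> adapted (fun p => \sum_z f (p.1, z) * g (z, p.2)).
Proof.
move=> af ag t p q tS pt qt.
(* A picked element supplies the common value on its class; the default 0 could only concern an
   empty class. *)
have sumE u : \sum_z f (u.1, z) * g (z, u.2) =
  \sum_(r in S) \sum_(s in S)
    (odflt 0 (omap f [pick v in r]) * odflt 0 (omap g [pick v in s]))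
      *+ inum r s u.
  rewrite (partition_big (fun z => pblock S (u.1, z)) (mem S)) /=; last first.
    by move=> z _; apply: coherent_pblock.
  apply: eq_bigr => r rS.
  rewrite (partition_big (fun z => pblock S (z, u.2)) (mem S)) /=; last first.
    by move=> z _; apply: coherent_pblock.
  apply: eq_bigr => s sS; rewrite /inum -sumr_const.
  apply: eq_big => [z|z].
    by rewrite inE !coherent_blockE.
  rewrite -!coherent_blockE // => /andP[ur us].
  case: pickP => [v vr|/(_ (u.1, z))]; last by rewrite ur.
  case: pickP => [w ws|/(_ (z, u.2))]; last by rewrite us.
  by rewrite /= (af r v (u.1, z)) // (ag s w (z, u.2)).
rewrite !sumE; apply: eq_bigr => r rS; apply: eq_bigr => s sS.
case/and4P: cohS => _ _ _ /forall_inP/(_ r rS)/forall_inP/(_ s sS).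
by move=> /forall_inP/(_ t tS)/forall_inP/(_ p pt)/forall_inP/(_ q qt)/eqP->.
Qed.

(** The witnesses [w] are counted by a product of two 0/1 matrices over [int], where the count
    vanishes only if there is no witness. *)
Lemma adapted_exists (f : T * T -> bool) (A : pred T) :
  adapted f -> adapted (fun p => A p.1) ->
  adapted (fun p => [exists w, f (p.1, w) && A w]).
Proof.
move=> af aA s p q sS ps qs.
have := adapted_mul (adapted_comp (fun b : bool => b%:R : int) af)
  (adapted_comp (fun b : bool => b%:R : int) aA) sS ps qs.
have E u : (\sum_w (f (u, w))%:R * (A w)%:R != 0 :> int) =
    [exists w, f (u, w) && A w].
  under eq_bigr do rewrite -natrM mulnb.
  rewrite -natr_sum pnatr_eq0 sum_nat_eq0 negb_forall.
  by apply: eq_existsb => w; rewrite /= eqb0 negbK.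
by rewrite /= => H; rewrite -!E H.
Qed.

Lemma is_union_sub (X s : {set T * T}) p :
  is_union S X -> s \in S -> p \in s -> p \in X -> s \subset X.
Proof.
move=> /eqP XE sS ps; rewrite {1}XE => /bigcupP[r /andP[rS rX] pr].
by move: ps pr; rewrite !coherent_blockE // => /eqP<- /eqP->.
Qed.

Lemma adapted_is_union (X : {set T * T}) :
  is_union S X -> adapted (fun p => p \in X).
Proof.
move=> UX s p q sS ps qs; apply/idP/idP => [pX|qX].
  exact: subsetP (is_union_sub UX sS ps pX) _ qs.
exact: subsetP (is_union_sub UX sS qs qX) _ ps.
Qed.

Lemma adapted_union_of_fibers (D : {set T}) :
  union_of_fibers S D -> adapted (fun p => p.1 \in D).
Proof.
move=> /eqP DE.
have aD : adapted (fun p => p \in diag_on D).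
  apply: adapted_is_union; apply/eqP/setP => p; apply/idP/bigcupP.
    rewrite inE => /andP[pd]; rewrite DE => /bigcupP[G].
    rewrite inE => /andP[GS GD] pG; exists (diag_on G); last by rewrite inE pd.
    rewrite GS; apply/subsetP => q; rewrite !inE => /andP[-> /(subsetP GD)].
    by rewrite -DE.
  by case=> s /andP[_ sD]; apply: (subsetP sD).
(* Multiplying the diagonal matrix of [D] by the all-ones matrix gives the indicator of [D] in the
   first coordinate. *)
have := @adapted_mul int (fun p => (p \in diag_on D)%:R) (fun=> 1)
  (adapted_comp (fun b : bool => b%:R) aD) (fun _ _ _ _ _ _ => erefl).
move/(adapted_comp (fun x : int => x == 1)) => aD1 s p q sS ps qs.
have := aD1 s p q sS ps qs; rewrite /=.
have E u : \sum_z ((u.1, z) \in diag_on D)%:R * 1 = (u.1 \in D)%:R :> int.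
  rewrite (bigD1 u.1) //= inE eqxx mulr1 big1 ?addr0 // => z zu.
  by rewrite inE eq_sym (negPf zu) mul0r.
by rewrite !E; do 2!case: (_ \in D).
Qed.

(** Transposition carries [h] over to the second coordinate, so a class determines both entries of
    its pairs. *)
Lemma complete_of_injective (R : Type) (h : T -> R) :
  injective h -> adapted (fun p => h p.1) -> complete S.
Proof.
move=> h_inj ah; apply/forall_inP => s sS.
have [p ps] : exists p, p \in s.
  apply/set0Pn; apply: contraTneq sS => ->.
  by case/and4P: cohS => /and3P[].
apply/cards1P; exists p; apply/setP => q; rewrite inE.
apply/idP/eqP => [qs|-> //].
apply/pair_eqP/andP; split; apply/eqP/h_inj; first exact: ah qs ps.
exact: adapted_swap ah _ _ _ sS qs ps.
Qed.
End Adapted.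

(** * The discrete configuration and generalized bases *)

Section Discrete.
Variable T : finType.

Definition discrete : {set {set T * T}} := [set [set p] | p in [set: T * T]].

Lemma set1_discrete p : [set p] \in discrete.
Proof. exact: imset_f. Qed.

Lemma discreteP s : reflect (exists p, s = [set p]) (s \in discrete).
Proof.
by apply: (iffP imsetP) => [[p _ ->]|[p ->]]; exists p.
Qed.

Lemma is_union_discrete X : is_union discrete X.
Proof.
apply/eqP/setP => p; apply/idP/bigcupP => [pX|[s /andP[_ /subsetP]]]; last exact.
by exists [set p]; rewrite ?inE // set1_discrete sub1set.
Qed.

Lemma coherent_discrete : coherent discrete.
Proof.
apply/and4P; split.
- apply/and3P; split.
  + rewrite /cover; apply/eqP/setP => p; rewrite inE; apply/bigcupP.
    by exists [set p]; rewrite ?set1_discrete ?inE.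
  + apply/trivIsetP => A B /discreteP[p ->] /discreteP[q ->] pq.
    by rewrite disjoints1 inE; apply: contraNneq pq => ->.
  + by apply/negP => /discreteP[p /setP/(_ p)]; rewrite !inE eqxx.
- exact: is_union_discrete.
- apply/forall_inP => _ /discreteP[p ->]; apply/discreteP.
  exists (p.2, p.1); apply/setP => q; rewrite !inE.
  by rewrite -!pair_eqE /pair_eq /= andbC.
- apply/forall_inP => r _; apply/forall_inP => s _; apply/forall_inP.
  move=> _ /discreteP[p ->]; apply/forall_inP => q /set1P->.
  by apply/forall_inP => q' /set1P->.
Qed.

Lemma union_of_fibers_discrete D : union_of_fibers discrete D.
Proof.
apply/eqP/setP => x; apply/idP/bigcupP => [xD|[s /andP[_ /subsetP]]]; last exact.
exists [set x]; last by rewrite inE.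
rewrite sub1set xD andbT inE; apply/discreteP; exists (x, x).
apply/setP => -[y z]; rewrite !inE /= xpair_eqE.
by case: (y =P x) => [->|]; rewrite ?andbT ?andbF // eq_sym.
Qed.

Lemma complete_discrete : complete discrete.
Proof. by apply/forall_inP => _ /discreteP[p ->]; rewrite cards1. Qed.

Lemma fission_discrete S : coherent S -> complete S -> fission discrete S.
Proof.
move=> cohS /forall_inP comS; rewrite /fission cohS.
apply/forall_inP => _ /discreteP[p ->]; apply/eqP/setP => q.
apply/idP/bigcupP => [/set1P->|[s /andP[_ /subsetP]]]; last exact.
have /comS/cards1P[r pE] := coherent_pblock cohS p.
have := coherent_pblock_id cohS p; rewrite pE => /set1P pr.
exists (pblock S p); last exact: coherent_pblock_id.
by rewrite coherent_pblock // pE pr subxx.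
Qed.

(* The smallest fission is then the discrete one. *)
Lemma gen_baseI (S : {set {set T * T}}) (Pi : {set {set T}}) :
  (forall S', fission S S' -> {in Pi, forall D, union_of_fibers S' D} ->
     complete S') ->
  gen_base S Pi.
Proof.
move=> comS; apply/existsP; exists discrete; rewrite complete_discrete andbT.
apply/and3P; split.
- rewrite /fission coherent_discrete; apply/forall_inP => s _.
  exact: is_union_discrete.
- by apply/forall_inP => D _; apply: union_of_fibers_discrete.
- apply/forallP => S'; apply/implyP => /andP[fS /forall_inP uS].
  by apply: fission_discrete; [case/andP: fS | apply: comS].
Qed.
End Discrete.

Lemma bigmin_leq (I : finType) (P : pred I) (F : I -> nat) d i :
  P i -> (\big[minn/d]_(j | P j) F j <= F i)%N.
Proof.
move=> Pi; have : i \in index_enum I by rewrite mem_index_enum.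
elim: (index_enum I) => // j r IHr; rewrite inE big_cons => /predU1P[<-|ir].
  by rewrite Pi geq_minl.
by case: ifP => _; rewrite ?IHr // geq_min IHr ?orbT.
Qed.

(** * Multiplicative characters of a finite field *)

Lemma card_field_gt0 (F : finFieldType) : (0 < #|F|.-1)%N.
Proof. by rewrite -ltnS (ltn_predK (finNzRing_gt1 F)) finNzRing_gt1. Qed.

Lemma finField_expf_pred_card (F : finFieldType) (x : F) :
  x != 0 -> x ^+ #|F|.-1 = 1.
Proof.
move=> x0; apply: (mulfI x0).
by rewrite -exprS (ltn_predK (finNzRing_gt1 F)) expf_card mulr1.
Qed.

Lemma finField_prim_root (F : finFieldType) :
  {g : F | #|F|.-1.-primitive_root g}.
Proof.
apply/sigW; suff /hasP[g _ gP] : has #|F|.-1.-primitive_root (enum (predC1 (0 : F))).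
  by exists g.
apply: has_prim_root; rewrite ?enum_uniq ?card_field_gt0 //.
- apply/allP => x; rewrite mem_enum inE => x0.
  by apply/unity_rootP/finField_expf_pred_card.
- by rewrite -cardE cardC1.
Qed.

Lemma primitive_root_neq0 (R : nzRingType) n (z : R) :
  n.-primitive_root z -> z != 0.
Proof.
move=> zP; apply/eqP => z0; have := prim_expr_order zP.
rewrite z0 expr0n gtn_eqF ?(prim_order_gt0 zP) // => /eqP.
by rewrite eq_sym oner_eq0.
Qed.

Section Characters.
Variables (F : finFieldType) (g : F).
Hypothesis gP : #|F|.-1.-primitive_root g.
Local Notation N := #|F|.-1.

(** The default 0 is reached only at [x = 0]. *)
Definition dlog (x : F) : nat := odflt 0 (omap val [pick i : 'I_N | x == g ^+ i]).

Lemma dlogK x : x != 0 -> g ^+ dlog x = x.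
Proof.
move=> /finField_expf_pred_card/(prim_rootP gP)[i xi]; rewrite /dlog.
by case: pickP => [j /eqP->|/(_ i)] //; rewrite xi eqxx.
Qed.

Section Values.
Variables (L : fieldType) (z : L).
Hypothesis zP : N.-primitive_root z.

(* The value at 0 is 0 even when k = 0. *)
Definition chi (k : nat) (x : F) : L :=
  if x == 0 then 0 else z ^+ (k * dlog x).

Lemma chi0 k : chi k 0 = 0. Proof. by rewrite /chi eqxx. Qed.

Lemma chi_neq0 k x : x != 0 -> chi k x != 0.
Proof. by move=> x0; rewrite /chi (negPf x0) expf_neq0 // (primitive_root_neq0 zP).
Qed.

Lemma chiM k x y : chi k (x * y) = chi k x * chi k y.
Proof.
rewrite /chi mulf_eq0; have [|x0] := eqVneq x 0; first by rewrite mul0r.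
have [|y0 /=] := eqVneq y 0; first by rewrite mulr0.
rewrite -exprD -mulnDr ![(k * _)%N]mulnC !exprM; congr (_ ^+ k).
apply/eqP; rewrite (eq_prim_root_expr zP) -(eq_prim_root_expr gP).
by rewrite exprD !dlogK // mulf_neq0.
Qed.

Lemma chi1 k : chi k 1 = 1.
Proof.
by apply: (mulfI (chi_neq0 k (oner_neq0 F))); rewrite -chiM !mulr1.
Qed.

Lemma chiD k l x : chi (k + l) x = chi k x * chi l x.
Proof.
by rewrite /chi; case: eqP => _; rewrite ?mul0r // mulnDl exprD.
Qed.

Lemma chi_mod k l x : k = l %[mod N] -> chi k x = chi l x.
Proof.
move=> kl; rewrite /chi; case: eqP => // _; apply/eqP.
by rewrite (eq_prim_root_expr zP) -modnMml kl modnMml.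
Qed.

Lemma sum_chi k : \sum_x chi k x = if (N %| k)%N then N%:R else 0.
Proof.
have [Nk|Nk] := ifP.
  rewrite (bigD1 0) //= chi0 add0r (eq_bigr (fun=> 1)) => [|x x0].
    by rewrite sumr_const cardC1.
  rewrite (@chi_mod k 0) ?mod0n //; first by rewrite /chi (negPf x0) mul0n.
  exact/eqP.
have g0 := primitive_root_neq0 gP.
have chig : chi k g != 1.
  rewrite /chi (negPf g0) -(prim_order_dvd zP) mulnC.
  suff -> : ((N %| dlog g * k) = (N %| k))%N by rewrite Nk.
  have /eqP := dlogK g0; rewrite -[X in _ == X]expr1 (eq_prim_root_expr gP) => /eqP dg.
  by rewrite /dvdn -modnMml dg modnMml mul1n.
have: (chi k g - 1) * \sum_x chi k x = 0.
  rewrite mulrBl mul1r mulr_sumr [X in _ - X](reindex_inj (mulfI g0)) /=.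
  by under [X in _ - X]eq_bigr do rewrite chiM; rewrite subrr.
by move/eqP; rewrite mulf_eq0 subr_eq0 (negPf chig) => /eqP.
Qed.

Lemma sum_chi_mulV k l :
  \sum_x chi k x * chi l x^-1 = if k == l %[mod N] then N%:R else 0.
Proof.
(* [l'] represents [- l] modulo [N], so [chi l x^-1] becomes [chi l' x]. *)
have [l' l'E] : exists l', (N %| l + l')%N.
  exists (l * N.-1)%N; rewrite -mulnS (ltn_predK (card_field_gt0 F)).
  exact: dvdn_mull.
have -> : (k == l %[mod N]) = (N %| k + l')%N.
  by rewrite -(eqn_modDr l') (eqP l'E) eq_sym.
rewrite -sum_chi; apply: eq_bigr => x _; rewrite chiD; congr (_ * _).
have [->|x0] := eqVneq x 0; first by rewrite invr0 !chi0.
apply: (mulfI (chi_neq0 l x0)); rewrite -chiM divff // chi1 -chiD.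
by rewrite (@chi_mod _ 0) ?(eqP l'E) ?mod0n // /chi (negPf x0) mul0n.
Qed.

Lemma sum_chi_exponent x :
  \sum_(k < N) chi k x = if x == 1 then N%:R else 0.
Proof.
have [->|x1] := eqVneq x 1.
  by rewrite (eq_bigr (fun=> 1)) => [|k _]; rewrite ?chi1 // sumr_const card_ord.
have [->|x0] := eqVneq x 0; first by rewrite big1 // => k _; rewrite chi0.
have w1 : z ^+ dlog x != 1.
  by rewrite -(prim_order_dvd zP) (prim_order_dvd gP) dlogK.
rewrite (eq_bigr (fun k : 'I_N => (z ^+ dlog x) ^+ k)) => [|k _]; last first.
  by rewrite /chi (negPf x0) mulnC exprM.
have := subrX1 (z ^+ dlog x) N; rewrite exprAC (prim_expr_order zP) expr1n subrr.
by move/esym/eqP; rewrite mulf_eq0 subr_eq0 (negPf w1) => /eqP.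
Qed.

Lemma chi_eq_expr k l x : x != 0 -> chi k x = chi l x -> x ^+ k = x ^+ l.
Proof.
move=> x0; rewrite /chi (negPf x0) => /eqP; rewrite (eq_prim_root_expr zP).
by rewrite -(eq_prim_root_expr gP) ![(_ * dlog x)%N]mulnC !exprM dlogK // => /eqP.
Qed.

Lemma chi_inj : injective (chi 1).
Proof.
move=> x y; have [->|x0] := eqVneq x 0.
  rewrite chi0 => /esym/eqP; apply: contraTeq => y0.
  by rewrite chi_neq0 // eq_sym.
have [->|y0] := eqVneq y 0.
  by rewrite chi0 => /eqP; rewrite (negPf (chi_neq0 _ x0)).
rewrite /chi (negPf x0) (negPf y0) !mul1n => /eqP.
by rewrite (eq_prim_root_expr zP) -(eq_prim_root_expr gP) !dlogK // => /eqP.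
Qed.
End Values.

Lemma chi_self k x : chi g k x = if x == 0 then 0 else x ^+ k.
Proof. by rewrite /chi; case: eqP => // /eqP x0; rewrite mulnC exprM dlogK. Qed.

(** Over [F] too, [X^N - 1] is the product of the ['Phi_d] with [d] dividing [N]. If [g] is a root
    of ['Phi_d], then [g ^+ d = 1], and primitivity forces [d = N]. *)
Lemma Cyclotomic_root : root (map_poly intr 'Phi_N) g.
Proof.
have N0 := card_field_gt0 F.
have rootE d : (0 < d)%N ->
    has (fun e => root (map_poly intr 'Phi_e) g) (divisors d) = (g ^+ d == 1).
  move=> d0; have := congr1 (fun P => (map_poly intr P).[g]) (prod_Cyclotomic d0).
  rewrite rmorph_prod horner_prod rmorphB /= map_polyXn rmorph1 !hornerE.
  by move=> E; rewrite -[RHS]subr_eq0 -E prodf_seq_eq0.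
have /hasP[d] : has (fun e => root (map_poly intr 'Phi_e) g) (divisors N).
  by rewrite rootE // (prim_expr_order gP).
rewrite -dvdn_divisors // => dN rd; suff -> : N = d by [].
have d0 := dvdn_gt0 N0 dN.
apply/eqP; rewrite eqn_dvd dN andbT (prim_order_dvd gP) -rootE //.
by apply/hasP; exists d; rewrite -?dvdn_divisors.
Qed.

(* Z[z] maps to F by z |-> g since both are roots of the cyclotomic polynomial. *)
Lemma root_prim_root_reduce (z : algC) (P : {poly int}) :
  N.-primitive_root z -> root (map_poly intr P) z -> root (map_poly intr P) g.
Proof.
move=> zP; rewrite (Pdiv.RingMonic.rdivp_eq (Cyclotomic_monic N) P).
set Q := Pdiv.Ring.rdivp _ _; set R := Pdiv.Ring.rmodp _ _.
have R_lt : (size R < size 'Phi_N)%N.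
  by rewrite Pdiv.Ring.ltn_rmodp monic_neq0 // Cyclotomic_monic.
have zPhi : root (map_poly intr 'Phi_N) z.
  by rewrite (Cintr_Cyclotomic zP) root_cyclotomic.
rewrite !rmorphD !rmorphM /= !rootE !hornerE (eqP zPhi) (eqP Cyclotomic_root).
rewrite !mulr0 !add0r => Rz.
(* The remainder vanishes at [z] but has smaller degree than ['Phi_N], the minimal polynomial of [z]
   over the rationals. *)
suff -> : R = 0 by rewrite rmorph0 horner0.
have [p [pE _] /(_ (map_poly intr R)) pdvd] := minCpolyP z.
have mapE (q : {poly int}) :
    map_poly ratr (map_poly intr q : {poly rat}) = map_poly intr q :> {poly algC}.
  by rewrite -map_poly_comp; apply: eq_map_poly => i /=; rewrite ratr_int.
have pR : p %| map_poly intr R by rewrite -pdvd mapE.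
have sp : size p = size 'Phi_N.
  rewrite -(size_map_poly (ratr : {rmorphism rat -> algC})) -pE.
  rewrite (minCpoly_cyclotomic zP).
  by rewrite -(Cintr_Cyclotomic zP) size_map_inj_poly //; apply: intr_inj.
apply/eqP; apply: contraTT R_lt => R0; rewrite -leqNgt -sp.
rewrite -(size_map_inj_poly (intr_inj : injective (intr : int -> rat))) //.
by apply: dvdp_leq => //; rewrite map_poly_eq0_id0 ?intr_eq0 // lead_coef_eq0.
Qed.

(** Both sums are integer polynomials evaluated at [z], with exponents given by [dlog]; evaluating
    the same polynomials at [g] gives the sums in [F]. *)
Lemma sum_chi_reduce (z : algC) (X : {set F}) k l :
  N.-primitive_root z ->
  \sum_(x in X) chi z k x = \sum_(x in X) chi z l x ->
  \sum_(x in X) chi g k x = \sum_(x in X) chi g l x.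
Proof.
move=> zP /eqP; rewrite -subr_eq0 => H; apply/eqP; rewrite -subr_eq0.
pose P j : {poly int} := \sum_(x in X | x != 0) 'X^(j * dlog x).
have PE (L : fieldType) (w : L) j :
    (map_poly intr (P j)).[w] = \sum_(x in X) chi w j x.
  rewrite rmorph_sum horner_sum /= [RHS]big_mkcond /= big_mkcond /=.
  apply: eq_bigr => x _; rewrite /chi; case: (x \in X) => //=.
  by case: eqP => //= _; rewrite map_polyXn hornerXn.
have: root (map_poly intr (P k - P l)) z.
  by rewrite rmorphB rootE hornerD hornerN !PE.
by move/(root_prim_root_reduce zP); rewrite rmorphB rootE hornerD hornerN !PE.
Qed.
End Characters.

(** * Fissions in which three points are fibers *)

(** Write [j = u * P] with [P] a power of [p] and [u] prime to [p]. Comparing coefficients of [X^P]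
    in [(1 + X)^j = (1 + X^P)^u] gives ['C(j, P) = u], nonzero in [R], so [P < j] is impossible. *)
Lemma pchar_bin_eq0_expn (R : fieldType) p j :
  p \in [pchar R] -> (0 < j)%N ->
  (forall a, (0 < a < j)%N -> 'C(j, a)%:R = 0 :> R) -> exists l, j = (p ^ l)%N.
Proof.
move=> pR j0 binj; have p_pr := pcharf_prime pR.
have [u pu jE] := pfactor_coprime p_pr j0.
exists (logn p j); rewrite [LHS]jE -[RHS]mul1n; congr muln.
set P := (p ^ _)%N in jE.
have P0 : (0 < P)%N by rewrite expn_gt0 prime_gt0.
have PX : (1 + 'X : {poly R}) ^+ P = 1 + 'X^P.
  rewrite exprDn_pchar ?expr1n // pnatX; apply/orP; left.
  by rewrite pnatE // pchar_poly.
have coefE n (w : {poly R}) : (1 + w) ^+ n = \sum_(i < n.+1) w ^+ i *+ 'C(n, i).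
  by rewrite exprDn; apply: eq_bigr => i _; rewrite expr1n mul1r.
have /(congr1 (fun w : {poly R} => w`_P)) : (1 + 'X) ^+ j = (1 + 'X^P) ^+ u :> {poly R}.
  by rewrite jE mulnC exprM PX.
rewrite !coefE !coef_sum => E.
have u0 : (0 < u)%N by case: u jE j0 {pu E} => // ->.
have : 'C(j, P)%:R = u%:R :> R.
  have Pj : (P < j.+1)%N by rewrite ltnS jE leq_pmull.
  have u1 : (1 < u.+1)%N by [].
  move: E; rewrite (bigD1 (Ordinal Pj)) //= coefMn coefXn eqxx.
  rewrite big1 ?addr0 => [->|i ij]; last first.
    rewrite coefMn coefXn; case: eqP => [E|]; rewrite ?mul0rn //.
    by case/eqP: ij; apply: val_inj.
  rewrite (bigD1 (Ordinal u1)) //= expr1 coefMn coefXn eqxx bin1.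
  rewrite big1 ?addr0 // => i i1; rewrite -exprM coefMn coefXn.
  rewrite -[X in X == _]muln1 eqn_pmul2l // eq_sym.
  by case: eqP => [E|]; rewrite ?mul0rn //; case/eqP: i1; apply: val_inj.
apply: contra_eq => u1; rewrite binj; last first.
  by rewrite P0 jE -[X in (X < _)%N]mul1n ltn_pmul2r // ltn_neqAle eq_sym u1.
by rewrite eq_sym -(dvdn_pcharf pR) -prime_coprime.
Qed.

Lemma mul_bin_bin n j b : (b <= j)%N ->
  ('C(n, j) * 'C(j, b) = 'C(n, b) * 'C(n - b, j - b))%N.
Proof.
move=> bj; have [nj|jn] := ltnP n j.
  rewrite [in LHS]bin_small // mul0n; have [nb|bn] := ltnP n b.
    by rewrite bin_small.
  by rewrite (@bin_small (n - b)) ?muln0 //; lia.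
have bn := leq_trans bj jn.
have f0 : (0 < b`! * (j - b)`! * (n - j)`!)%N by rewrite !muln_gt0 !fact_gt0.
apply/eqP; rewrite -(eqn_pmul2r f0); apply/eqP.
transitivity (n`!).
  by rewrite -mulnA (mulnA 'C(j, b)) (bin_fact bj) bin_fact.
rewrite -!mulnA (mulnCA _ b`!) -(bin_fact bn); congr muln; congr muln.
have <- := @bin_fact (n - b) (j - b) (leq_sub2r b jn).
by rewrite subnBA // subnK.
Qed.

Lemma expn_add_eq p a b c d : prime p -> odd p ->
  (p ^ a + p ^ b = p ^ c + p ^ d)%N -> (a = c /\ b = d) \/ (a = d /\ b = c).
Proof.
move=> p_pr p_odd E; have p1 := prime_gt1 p_pr.
(* An exponent of one side that is minimal there and strictly below both exponents of the other
   would make [p] divide [1 + p ^ n] for some [n], hence 1 or 2. *)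
have low a' b' c' d' : (a' <= b')%N -> (a' < c')%N -> (a' < d')%N ->
    (p ^ a' + p ^ b' <> p ^ c' + p ^ d')%N.
  move=> ab ac ad E'.
  have : (p ^ a'.+1 %| p ^ c' + p ^ d')%N by rewrite dvdn_add ?dvdn_exp2l.
  rewrite -E' -(subnKC ab) expnD -{1}[(p ^ a')%N]muln1 -mulnDr.
  rewrite expnSr dvdn_pmul2l ?expn_gt0 ?prime_gt0 //.
  case: (b' - a')%N => [|n]; last by rewrite dvdn_addl ?dvdn_exp // dvdn1 gtn_eqF.
  by move=> p2; have := @dvdn_leq p 2 isT p2; lia.
have := low a b c d; have := low b a c d; have := low c d a b; have := low d c a b.
have inj u v : (p ^ u = p ^ v)%N -> u = v by move/(expnI p1).
have : [\/ a = c, a = d, b = c | b = d] -> a = c /\ b = d \/ a = d /\ b = c.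
  case=> H; [left | right | right | left]; split=> //; apply: inj; rewrite H in E; lia.
by move=> H *; apply: H; case: (ltngtP a c) => ?; case: (ltngtP a d) => ?;
  case: (ltngtP b c) => ?; case: (ltngtP b d) => ?;
  solve [constructor; lia | exfalso; lia].
Qed.

(** Representatives run from 1 to [n], not from 0 to [n - 1], because sums of two exponents bounded
    by [m] may reach [N]. *)
Lemma modn_eq_pos n u v : (0 < u <= n)%N -> (0 < v <= n)%N ->
  u = v %[mod n] -> u = v.
Proof.
move=> /andP[u0 un] /andP[v0 vn]; have n0 := leq_trans u0 un.
rewrite -(prednK u0) -(prednK v0) => /eqP.
by rewrite -![_.-1.+1]add1n eqn_modDl !modn_small ?prednK // => /eqP->.
Qed.

(** * The Schur ring of ratios and its dual equivalence on exponents *)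

Section ThreePoints.
Variables (F : finFieldType) (S : {set {set F * F}}).
Hypothesis cohS : coherent S.
Variables (g : F) (z : algC).
Local Notation N := #|F|.-1.
Hypotheses (gP : N.-primitive_root g) (zP : N.-primitive_root z).
Hypothesis a0 : adapted S (fun p : F * F => p.1 == 0).

(** Since [x / 0 = 0], all pairs with a zero coordinate receive the value [h 0]. *)
Definition ratio_adapted (R : Type) (h : F -> R) :=
  adapted S (fun p => h (p.1 / p.2)).

Definition ratio_set (X : {set F}) : bool :=
  [forall s in S, forall p in s, forall q in s,
     (p.1 / p.2 \in X) == (q.1 / q.2 \in X)].

Lemma ratio_setP (X : {set F}) :
  reflect (ratio_adapted (fun t => t \in X)) (ratio_set X).
Proof.
apply: (iffP forall_inP) => [aX s p q sS ps qs|aX s sS].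
  by apply/eqP; move/forall_inP/(_ p ps)/forall_inP/(_ q qs): (aX s sS).
by apply/forall_inP => p ps; apply/forall_inP => q qs; apply/eqP; apply: aX ps qs.
Qed.

Lemma ratio_adapted_inv (R : Type) (h : F -> R) :
  ratio_adapted h -> ratio_adapted (fun t => h t^-1).
Proof.
move=> /(adapted_swap cohS) ah s p q sS ps qs.
by have := ah s p q sS ps qs; rewrite /= !invf_div.
Qed.

(** The sum is cut along the level sets of [h], which are ratio sets. The ring is arbitrary so that
    the lemma serves both [algC] and [F]. *)
Lemma eq_sum_ratio_adapted (R : pzRingType) (h u v : F -> R) :
  (forall X, ratio_set X -> \sum_(t in X) u t = \sum_(t in X) v t) ->
  ratio_adapted h -> \sum_t h t * u t = \sum_t h t * v t.
Proof.
(* Level sets replace values as the index because [R] need not be finite. *)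
move=> uv ah; pose lev t := [set s | h s == h t].
have half w : \sum_t h t * w t =
    \sum_(X : {set F}) \sum_(t | lev t == X) h t * w t.
  exact: partition_big.
rewrite !half; apply: eq_bigr => X _.
case: (pickP (fun t => lev t == X)) => [t0 /eqP <-|X0]; last by rewrite !big_pred0.
have levE t : (lev t == lev t0) = (t \in lev t0).
  rewrite inE; apply/eqP/eqP => [/setP/(_ t)|E].
    by rewrite !inE eqxx => /esym/eqP.
  by apply/setP => s; rewrite !inE E.
have sumE w : \sum_(t | lev t == lev t0) h t * w t =
    h t0 * \sum_(t in lev t0) w t.
  rewrite mulr_sumr; apply: eq_big => [t|t]; first exact: levE.
  by rewrite levE inE => /eqP->.
rewrite !sumE uv //; apply/ratio_setP.
by move=> s p q sS ps qs; rewrite !inE (ah s p q).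
Qed.

(* The classes of the Schur ring dual to the one formed by the ratio sets. *)
Definition ceq (k l : nat) : bool :=
  [forall X : {set F}, ratio_set X ==>
    (\sum_(t in X) chi g z k t == \sum_(t in X) chi g z l t)].

Lemma ceq_refl k : ceq k k.
Proof. by apply/forallP => X; apply/implyP. Qed.

(** The Fourier transform on the multiplicative group; [h 0] is ignored as [chi] vanishes at 0. *)
Definition hat (h : F -> algC) k := \sum_t h t * chi g z k t.

Lemma hat_ceq h k l : ratio_adapted h -> ceq k l -> hat h k = hat h l.
Proof.
move=> ah /forallP kl; apply: eq_sum_ratio_adapted ah => X XS.
by apply/eqP; move/implyP: (kl X); apply.
Qed.

(** Substituting [s = w / y] turns multiplicative convolution into a matrix product; the vanishing
    at 0 settles the case [y = 0]. *)
Lemma ratio_adapted_conv (h1 h2 : F -> algC) :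
  h1 0 = 0 -> h2 0 = 0 -> ratio_adapted h1 -> ratio_adapted h2 ->
  ratio_adapted (fun t => \sum_s h1 (t / s) * h2 s).
Proof.
move=> h10 h20 a1 a2 s p q sS ps qs.
have E u : \sum_s h1 (u.1 / u.2 / s) * h2 s = \sum_w h1 (u.1 / w) * h2 (w / u.2).
  have [->|u0] := eqVneq u.2 0.
    by rewrite !big1 // => w _; rewrite invr0 ?mulr0 ?h20 ?mulr0 ?mul0r ?h10 ?mul0r.
  rewrite [RHS](reindex_inj (mulIf u0)) /=; apply: eq_bigr => w _.
  by rewrite mulfK // invfM mulrA mulrAC.
by rewrite !E; apply: (adapted_mul cohS a1 a2) ps qs.
Qed.

Lemma hat_conv h1 h2 k : h2 0 = 0 ->
  hat (fun t => \sum_s h1 (t / s) * h2 s) k = hat h1 k * hat h2 k.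
Proof.
move=> h20; rewrite /hat mulr_sumr; under eq_bigr do rewrite mulr_suml.
rewrite exchange_big; apply: eq_bigr => s _ /=.
have [->|s0] := eqVneq s 0.
  by rewrite chi0 mulr0 mulr0 big1 // => t _; rewrite h20 mulr0 mul0r.
rewrite mulr_suml (reindex_inj (mulIf s0)) /=; apply: eq_bigr => t _.
by rewrite mulfK // chiM // mulrACA.
Qed.

Lemma adapted_eq : adapted S (fun p : F * F => p.1 == p.2).
Proof.
have /and4P[_ dS _ _] := cohS.
move=> s p q sS ps qs; have := adapted_is_union cohS dS sS ps qs.
by rewrite !inE.
Qed.

Lemma ratio_adapted_eq1 : ratio_adapted (fun t => (t == 1)%:R : algC).
Proof.
have E (p : F * F) : (p.1 / p.2 == 1) = (p.1 == p.2) && (p.1 != 0).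
  have [->|p0] := eqVneq p.2 0.
    by rewrite invr0 mulr0 eq_sym oner_eq0; case: eqP.
  rewrite -(inj_eq (mulIf p0)) divfK // mul1r; case: eqP => // ->.
  by rewrite p0.
move=> s p q sS ps qs; rewrite !E.
by rewrite (adapted_eq sS ps qs) (a0 sS ps qs).
Qed.

(** As in interpolation, each exponent of [r] outside the class contributes one factor killing it.
    The factors are convolved, so their transforms multiply; [h 0 = 0] is carried along for the
    convolution. *)
Lemma ceq_separation k0 (r : seq nat) : exists h,
  [/\ ratio_adapted h, h 0 = 0, forall k, ceq k0 k -> hat h k = 1 &
      {in r, forall k, ~~ ceq k0 k -> hat h k = 0}].
Proof.
elim: r => [|k r [h [ah h0 h1 hr]]].
  exists (fun t => (t == 1)%:R); split=> //; first exact: ratio_adapted_eq1.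
    by rewrite eq_sym oner_eq0.
  move=> k _; rewrite /hat (bigD1 1) //= eqxx mul1r chi1 // big1 ?addr0 //.
  by move=> t /negPf->; rewrite mul0r.
have [kk0|] := boolP (ceq k0 k).
  exists h; split=> // l; rewrite inE => /predU1P[->|]; last exact: hr.
  by rewrite kk0.
rewrite negb_forall => /existsP[X]; rewrite negb_imply => /andP[XS].
set b := \sum_(t in X) _; set a := \sum_(t in X) _ => ab.
have ab0 : b - a != 0 by rewrite subr_eq0.
(* The indicator of 1 has transform 1 everywhere, so this affine correction of the indicator of [X]
   has transform 1 at [k0] and 0 at [k]. *)
pose h' t := ((t \in X)%:R * (t != 0)%:R - a * (t == 1)%:R) / (b - a).
have ah' : ratio_adapted h'.
  move=> s p q sS ps qs; rewrite /h'.
  rewrite (ratio_adapted_eq1 sS ps qs) ((ratio_setP _ XS) s p q) //.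
  have E (u : F * F) : (u.1 / u.2 != 0) = (u.1 != 0) && (u.2 != 0).
    by rewrite mulf_eq0 invr_eq0 negb_or.
  by rewrite !E (a0 sS ps qs) (adapted_swap cohS a0 sS ps qs).
have h'0 : h' 0 = 0.
  by rewrite /h' eqxx mulr0 eq_sym oner_eq0 mulr0 subrr mul0r.
have hat' l : hat h' l = (\sum_(t in X) chi g z l t - a) / (b - a).
  rewrite /hat /h'; under eq_bigr do rewrite mulrAC.
  rewrite -mulr_suml; congr (_ / _); under eq_bigr do rewrite mulrBl.
  rewrite sumrB; congr (_ - _).
    rewrite [RHS]big_mkcond; apply: eq_bigr => t _ /=.
    case: (t \in X); rewrite ?mul0r // mul1r.
    by case: eqP => [->|]; rewrite ?mul1r // chi0 mul0r.
  rewrite (bigD1 1) //= eqxx mulr1 chi1 // mulr1 big1 ?addr0 //.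
  by move=> t /negPf->; rewrite mulr0 mul0r.
exists (fun t => \sum_s h (t / s) * h' s); split.
- exact: ratio_adapted_conv.
- by rewrite big1 // => s _; rewrite mul0r h0 mul0r.
- move=> l k0l; rewrite hat_conv // h1 // mul1r -(hat_ceq ah' k0l) hat'.
  by rewrite divff.
- move=> l; rewrite inE hat_conv // => /predU1P[-> _|lr nl]; last first.
    by rewrite hr ?mul0r.
  by rewrite hat' subrr mul0r mulr0.
Qed.

Definition class_sum k0 t := \sum_(j < N | ceq k0 j) chi g z j t.

(** Take [h] whose transform is the indicator of the class on all exponents below [N]; Fourier
    inversion gives [class_sum k0 t^-1 = N%:R * h t]. *)
Lemma ratio_adapted_class_sum k0 : ratio_adapted (class_sum k0).
Proof.
have [h [ah h0 h1 hr]] := ceq_separation k0 (iota 0 N).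
have hE t : class_sum k0 t^-1 = N%:R * h t.
  have [->|t0] := eqVneq t 0.
    by rewrite invr0 h0 mulr0 /class_sum big1 // => j _; rewrite chi0.
  transitivity (\sum_(j < N) hat h j * chi g z j t^-1).
    rewrite /class_sum big_mkcond; apply: eq_bigr => j _.
    case: ifPn => [/h1->|/hr->]; rewrite ?mul1r ?mul0r //.
    by rewrite mem_iota add0n ltn_ord.
  rewrite /hat; under eq_bigr do rewrite mulr_suml.
  rewrite exchange_big (bigD1 t) //= [X in _ + X]big1 ?addr0 => [|s st].
    under eq_bigr do rewrite -mulrA -chiM // divff // chi1 // mulr1.
    by rewrite sumr_const card_ord mulr_natl.
  under eq_bigr do rewrite -mulrA -chiM //.
  rewrite -mulr_sumr sum_chi_exponent //.
  case: eqP => [E|_]; last by rewrite mulr0.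
  by move: st; rewrite -(inj_eq (mulIf (invr_neq0 t0))) E divff // eqxx.
move: (ratio_adapted_inv ah) => ah' s p q sS ps qs.
by rewrite -[_ / _]invrK -[q.1 / _]invrK !hE; congr (_ * _); apply: ah' ps qs.
Qed.

(* Positivity of the structure constants in characteristic zero is essential
   here: the multiplicities may vanish modulo the characteristic of F. *)
Lemma ceq_add a b j : (a < N)%N -> (b < N)%N -> ceq (a + b) j ->
  exists a' b', [/\ (a' < N)%N, (b' < N)%N, ceq a a', ceq b b' &
                    j = a' + b' %[mod N]].
Proof.
move=> aN bN abj.
(* The transform of [f] at [k] is [N] times the number of ways to write [k] modulo [N] as [a' + b']
   with [a'], [b'] in the two classes. It is nonzero at [a + b], hence at [j]. *)
pose f t := class_sum a t^-1 * class_sum b t^-1.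
have af : ratio_adapted f.
  by apply: adapted_comp2; apply: ratio_adapted_inv (ratio_adapted_class_sum _).
have hatf k : hat f k = (\sum_(a' < N | ceq a a') \sum_(b' < N | ceq b b')
    (k == a' + b' %[mod N]) * N)%:R.
  rewrite natr_sum /hat /f /class_sum.
  under [LHS]eq_bigr do rewrite mulr_suml mulr_suml.
  rewrite exchange_big; apply: eq_bigr => a' _ /=.
  rewrite natr_sum; under [LHS]eq_bigr do rewrite mulr_sumr mulr_suml.
  rewrite exchange_big; apply: eq_bigr => b' _ /=.
  under eq_bigr do rewrite mulrC -chiD.
  by rewrite sum_chi_mulV //; case: eqP; rewrite ?mul1n ?mul0n.
have: hat f (a + b) != 0.
  rewrite hatf pnatr_eq0 sum_nat_eq0 negb_forall; apply/existsP.
  exists (Ordinal aN); rewrite ceq_refl /= sum_nat_eq0 negb_forall.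
  apply/existsP; exists (Ordinal bN); rewrite ceq_refl /= eqxx mul1n.
  by rewrite -lt0n card_field_gt0.
rewrite (hat_ceq af abj) hatf pnatr_eq0 sum_nat_eq0 negb_forall.
case/existsP => a'; rewrite negb_imply sum_nat_eq0 negb_forall.
case/andP => aa' /existsP[b']; rewrite negb_imply muln_eq0 negb_or eqb0 negbK.
by case/and3P => bb' /eqP jE _; exists a', b'.
Qed.

(** * Exponents in the binomial expansion, and the class of 1 *)

Variable m : nat.
Hypothesis mN : (2 * m <= N)%N.
Hypothesis m0 : m%:R != 0 :> F.
Hypothesis aM : adapted S (fun p : F * F => (p.1 - p.2) ^+ m).

Lemma adapted_row (R : pzRingType) (f : F * F -> R) c :
  adapted S (fun p : F * F => p.1 == c) -> adapted S f ->
  adapted S (fun p => f (p.1, c)).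
Proof.
move=> ac af s p q sS ps qs.
have := adapted_mul cohS af (adapted_comp (fun b : bool => b%:R : R) ac) sS ps qs.
have E u : \sum_w f (u, w) * (w == c)%:R = f (u, c).
  rewrite (bigD1 c) //= eqxx mulr1 big1 ?addr0 // => w /negPf->.
  by rewrite mulr0.
by rewrite !E.
Qed.

Let m_gt0 : (0 < m)%N.
Proof. by case: m m0 => //; rewrite eqxx. Qed.

Let m_lt : (m < N)%N.
Proof. by apply: leq_trans mN; rewrite mul2n -addnn -addn1 leq_add2l m_gt0. Qed.

Lemma natr_pred_card_neq0 : N%:R != 0 :> F.
Proof. by rewrite natf_neq0_pchar; apply: pchar_prim_root gP. Qed.

(** For [t = x / y] nonzero the value is [(y - x)^m / x^m], and [x^m = (x - 0)^m] is adapted because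
    [a0] singles out 0. *)
Lemma adapted_bin_fun :
  ratio_adapted (fun t => if t == 0 then 0 else (t^-1 - 1) ^+ m).
Proof.
have ax : adapted S (fun p : F * F => p.1 ^+ m).
  move=> s p q sS ps qs; have := adapted_row a0 aM sS ps qs.
  by rewrite /= !subr0.
have E (p : F * F) : (if p.1 / p.2 == 0 then 0 else ((p.1 / p.2)^-1 - 1) ^+ m) =
    if (p.1 == 0) || (p.2 == 0) then 0 else (p.2 - p.1) ^+ m / p.1 ^+ m.
  rewrite mulf_eq0 invr_eq0; case: ifPn => //; rewrite negb_or => /andP[p10 p20].
  by rewrite invf_div -expr_div_n mulrBl divff.
move=> s p q sS ps qs; rewrite !E.
rewrite (a0 sS ps qs) (adapted_swap cohS a0 sS ps qs) (ax s p q) //.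
by rewrite (adapted_swap cohS aM sS ps qs).
Qed.

(** Off 0, [chi g g k] is the [k]-th power map, so orthogonality over [F] extracts the coefficient
    of [t^-k]; [m < N] keeps the exponents distinct modulo [N]. *)
Lemma sum_bin_fun k : (k < N)%N ->
  \sum_t (if t == 0 then 0 else (t^-1 - 1) ^+ m) * chi g g k t =
  (-1) ^+ (m - k) *+ 'C(m, k) * N%:R.
Proof.
move=> kN.
have E t : (if t == 0 then 0 else (t^-1 - 1) ^+ m) =
    \sum_(i < m.+1) (-1) ^+ (m - i) *+ 'C(m, i) * chi g g i t^-1.
  have [->|t0] := eqVneq t 0; first by rewrite big1 // => i _; rewrite invr0 chi0 mulr0.
  rewrite addrC exprDn; apply: eq_bigr => i _.
  by rewrite chi_self // invr_eq0 (negPf t0) mulrnAl.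
under eq_bigr do rewrite E mulr_suml.
rewrite exchange_big /=.
have sumE i : \sum_t (-1) ^+ (m - i) *+ 'C(m, i) * chi g g i t^-1 * chi g g k t =
    (-1) ^+ (m - i) *+ 'C(m, i) * if k == i %[mod N] then N%:R else 0.
  rewrite -(sum_chi_mulV gP gP) mulr_sumr; apply: eq_bigr => t _.
  by rewrite -mulrA; congr (_ * _); rewrite mulrC.
under eq_bigr do rewrite sumE.
have [km|mk] := leqP k m; last first.
  rewrite bin_small // mulr0n mul0r big1 // => i _.
  have iN : (i < N)%N by apply: leq_ltn_trans m_lt; rewrite -ltnS ltn_ord.
  by rewrite !modn_small // gtn_eqF ?mulr0 // (leq_trans (ltn_ord i)).
have km' : (k < m.+1)%N by [].
rewrite (bigD1 (Ordinal km')) //= eqxx big1 ?addr0 // => i ik.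
have iN : (i < N)%N by apply: leq_ltn_trans m_lt; rewrite -ltnS ltn_ord.
rewrite !modn_small //; case: eqP => [E'|_]; last by rewrite mulr0.
by case/eqP: ik; apply: val_inj.
Qed.

(* Both sides are coefficients of (t^-1 - 1) ^ m, whose level sets are
   ratio sets. *)
Lemma ceq_bin_neq0 k l : (k < N)%N -> (l < N)%N -> ceq k l ->
  'C(m, k)%:R != 0 :> F -> 'C(m, l)%:R != 0 :> F.
Proof.
move=> kN lN /forallP kl.
have: \sum_t (if t == 0 then 0 else (t^-1 - 1) ^+ m) * chi g g k t =
      \sum_t (if t == 0 then 0 else (t^-1 - 1) ^+ m) * chi g g l t.
  apply: eq_sum_ratio_adapted adapted_bin_fun => X XS.
  apply: (sum_chi_reduce gP zP); apply/eqP.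
  by move/implyP: (kl X); apply.
rewrite !sum_bin_fun // => E; apply: contraNneq => l0.
move: E; rewrite -[_ *+ 'C(m, l)]mulr_natr l0 mulr0 mul0r -mulr_natr => /eqP.
by rewrite !mulf_eq0 signr_eq0 (negPf natr_pred_card_neq0) orbF.
Qed.

(** The constant function 1 is ratio-adapted, and its transform is nonzero only at multiples of
    [N]. *)
Lemma ceq0l l : (l < N)%N -> ceq 0 l -> l = 0%N.
Proof.
have a1 : ratio_adapted (fun=> 1 : algC) by [].
move=> lN /(hat_ceq a1).
rewrite /hat; under eq_bigr do rewrite mul1r.
under [X in _ = X -> _]eq_bigr do rewrite mul1r.
rewrite !sum_chi // dvdn0; case: ifP => [/dvdn_leq|_ /eqP].
  by case: l lN => // l lN /(_ isT); rewrite leqNgt lN.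
by rewrite pnatr_eq0 gtn_eqF // card_field_gt0.
Qed.

Lemma ceq_sym k l : ceq k l = ceq l k.
Proof. by apply: eq_forallb => X; rewrite eq_sym. Qed.

Lemma ceq_bin_range a a' : (0 < a < N)%N -> (a' < N)%N -> ceq a a' ->
  'C(m, a)%:R != 0 :> F -> (0 < a' <= m)%N.
Proof.
case/andP => a0' aN a'N aa' /(ceq_bin_neq0 aN a'N aa') b0.
rewrite lt0n; apply/andP; split.
  apply: contraTneq aa' => ->; rewrite ceq_sym; apply: contraTN a0'.
  by move/(ceq0l aN) ->.
by rewrite leqNgt; apply: contra b0 => ma; rewrite bin_small.
Qed.

Let one_lt : (1 < N)%N.
Proof. exact: leq_ltn_trans m_gt0 m_lt. Qed.

Lemma ceq1_bin j : (j < N)%N -> ceq 1 j -> 'C(m, j)%:R != 0 :> F.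
Proof. by move=> jN j1; apply: ceq_bin_neq0 j1 _; rewrite ?one_lt ?bin1. Qed.

Lemma ceq1_le j : (j < N)%N -> ceq 1 j -> (0 < j <= m)%N.
Proof. by move=> jN j1; apply: ceq_bin_range j1 _; rewrite ?one_lt ?bin1. Qed.

(* If j were not a power of p, it would split as a + b with both binomial
   coefficients (m choose a), (m choose b) nonzero, and then 1 would be a sum of
   two positive exponents equivalent to a and b. *)
Lemma ceq1_expn p j : p \in [pchar F] -> (j < N)%N -> ceq 1 j ->
  exists l, j = (p ^ l)%N.
Proof.
move=> pF jN j1; have /andP[j0 jm] := ceq1_le jN j1.
have mj0 := ceq1_bin jN j1.
apply: (pchar_bin_eq0_expn pF) => // a /andP[a0' aj].
apply/eqP; apply: contraT => ja0.
have aN := ltn_trans aj jN.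
have bN : (j - a < N)%N by apply: leq_ltn_trans (leq_subr _ _) jN.
(* By [mul_bin_bin], ['C(m, b)] divides the nonzero product ['C(m, j) * 'C(j, b)]. *)
have sub_bin b : (b <= j)%N -> 'C(j, b)%:R != 0 :> F -> 'C(m, b)%:R != 0 :> F.
  move=> bj jb0; have: 'C(m, j)%:R * 'C(j, b)%:R != 0 :> F by rewrite mulf_neq0.
  by rewrite -natrM mul_bin_bin // natrM mulf_eq0 negb_or => /andP[].
have ma0 := sub_bin a (ltnW aj) ja0.
have mb0 : 'C(m, j - a)%:R != 0 :> F.
  by apply: sub_bin; rewrite ?leq_subr // bin_sub // ltnW.
have j1' : ceq (a + (j - a)) 1 by rewrite subnKC ?(ltnW aj) // ceq_sym.
have [a' [b' [a'N b'N aa' bb' E]]] := ceq_add aN bN j1'.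
have /andP[a'0 a'm] : (0 < a' <= m)%N.
  by apply: ceq_bin_range aa' ma0; rewrite ?a0'.
have /andP[b'0 b'm] : (0 < b' <= m)%N.
  by apply: ceq_bin_range bb' mb0; rewrite ?subn_gt0 ?aj.
have abN : (a' + b' <= N)%N.
  by apply: leq_trans mN; rewrite mul2n -addnn leq_add.
(* The sum [a' + b'] lies between 2 and [N], so it cannot be 1 modulo [N]. *)
have := @modn_eq_pos N 1 (a' + b').
rewrite abN (ltnW one_lt) addn_gt0 a'0 => /(_ isT isT E) /eqP.
by rewrite ltn_eqF // -[2%N]/(1 + 1)%N leq_add.
Qed.

(* The powers of an odd prime form a Sidon set. *)
Lemma ceq1_sidon i j k l : 2%:R != 0 :> F ->
  (i < N)%N -> (j < N)%N -> (k < N)%N -> (l < N)%N ->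
  ceq 1 i -> ceq 1 j -> ceq 1 k -> ceq 1 l ->
  (i + j == k + l %[mod N]) = (k == j) && (l == i) || (k == i) && (l == j).
Proof.
move=> F2 iN jN kN lN ci cj ck cl.
apply/idP/idP => [|/orP[/andP[/eqP-> /eqP->]|/andP[/eqP-> /eqP->]] //]; last first.
  by rewrite addnC.
have sumN u v : (u < N)%N -> (v < N)%N -> ceq 1 u -> ceq 1 v ->
    (0 < u + v <= N)%N.
  move=> uN vN /(ceq1_le uN)/andP[u0 um] /(ceq1_le vN)/andP[v0 vm].
  rewrite addn_gt0 u0; apply: leq_trans mN.
  by rewrite mul2n -addnn leq_add.
have [p p_pr pF] := finPcharP F.
have p_odd : odd p.
  case: (even_prime p_pr) => // p2; case/negP: F2.
  by rewrite -p2 pcharf0.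
have [a ai] := ceq1_expn pF iN ci; have [b bj] := ceq1_expn pF jN cj.
have [c ck'] := ceq1_expn pF kN ck; have [d dl] := ceq1_expn pF lN cl.
move=> /eqP E.
(* Both sums are at most [2 * m <= N], so the congruence is an equality of integers. *)
have := modn_eq_pos (sumN _ _ iN jN ci cj) (sumN _ _ kN lN ck cl) E.
rewrite ai bj ck' dl => /(expn_add_eq p_pr p_odd)[[-> ->]|[-> ->]].
  by rewrite !eqxx orbT.
by rewrite !eqxx.
Qed.

(** * The Sidon sum and completeness *)

Variable c : F.
Hypothesis a1 : adapted S (fun p : F * F => p.1 == 1).
Hypothesis ac : adapted S (fun p : F * F => p.1 == c).
Hypothesis F2 : 2%:R != 0 :> F.
Hypothesis c0 : c != 0.

Lemma class_sumM k x y : class_sum k (x * y) =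
  \sum_(j < N | ceq k j) chi g z j x * chi g z j y.
Proof. by apply: eq_bigr => j _; rewrite chiM. Qed.

(** Summing over [w] forces [i + j = k + l] modulo [N], that is [{i, j} = {k, l}]. The two matchings
    give the two products and their overlap the subtracted term. The middle factor depends on [w]
    alone, as [adapted_mul] requires. *)
Lemma sidon_sum (x y : F) :
  \sum_w class_sum 1 (x / w) * (class_sum 1 (w / c) * class_sum 1 w^-1)
    * class_sum 1 (w / y) =
  N%:R * (class_sum 1 c^-1 * class_sum 1 (x / y)
          + class_sum 1 (x / c) * class_sum 1 y^-1 - class_sum 1 (x / y / c)).
Proof.
pose I := fun j : 'I_N => ceq 1 j.
pose A (k : 'I_N) := chi g z k x.
pose B (i : 'I_N) := chi g z i c^-1.
pose C (j : 'I_N) := chi g z j y^-1.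
have delta (f : 'I_N -> algC) i : I i -> \sum_(l | I l) f l * (i == l)%:R = f i.
  move=> Ii; rewrite (bigD1 i) //= eqxx mulr1 big1 ?addr0 // => l /andP[_ li].
  by rewrite eq_sym (negPf li) mulr0.
have -> : \sum_w class_sum 1 (x / w) * (class_sum 1 (w / c) * class_sum 1 w^-1)
    * class_sum 1 (w / y) =
  \sum_(k | I k) \sum_(i | I i) \sum_(j | I j) \sum_(l | I l)
    A k * B i * C j * (if i + j == k + l %[mod N] then N%:R else 0).
  transitivity (\sum_w \sum_(k | I k) \sum_(i | I i) \sum_(j | I j)
    \sum_(l | I l) A k * B i * C j * (chi g z (i + j) w * chi g z (k + l) w^-1)).
    apply: eq_bigr => w _.
    transitivity (class_sum 1 (x / w) * (class_sum 1 (w / c) *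
        (class_sum 1 (w / y) * class_sum 1 w^-1))); first by ring.
    rewrite !class_sumM mulr_suml; apply: eq_bigr => k _.
    rewrite mulr_suml mulr_sumr; apply: eq_bigr => i _.
    rewrite mulr_suml !mulr_sumr; apply: eq_bigr => j _.
    rewrite !mulr_sumr; apply: eq_bigr => l _.
    by rewrite !chiD /A /B /C; ring.
  rewrite exchange_big; apply: eq_bigr => k _ /=.
  rewrite exchange_big; apply: eq_bigr => i _ /=.
  rewrite exchange_big; apply: eq_bigr => j _ /=.
  rewrite exchange_big; apply: eq_bigr => l _ /=.
  by rewrite -mulr_sumr sum_chi_mulV.
have inner (k i j : 'I_N) : I k -> I i -> I j ->
    \sum_(l | I l) A k * B i * C j * (if i + j == k + l %[mod N] then N%:R else 0) =
    N%:R * (A k * B i * C j * (k == j)%:R + A k * B i * C j * (k == i)%:R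
            - A k * B i * C j * (k == j)%:R * (k == i)%:R).
  move=> Ik Ii Ij; rewrite -mulr_sumr.
  have -> : \sum_(l | I l) (if i + j == k + l %[mod N] then N%:R else 0) =
      N%:R * ((k == j)%:R + (k == i)%:R - (k == j)%:R * (k == i)%:R) :> algC.
    transitivity (\sum_(l | I l) N%:R * ((k == j)%:R * (i == l)%:R +
       (k == i)%:R * (j == l)%:R - (k == j)%:R * (k == i)%:R * (i == l)%:R) : algC).
      apply: eq_bigr => l Il; rewrite ceq1_sidon // !(inj_eq val_inj).
      rewrite [l == i]eq_sym [l == j]eq_sym.
      have [<-|_] /= := eqVneq k j; have [<-|_] /= := eqVneq k i.
      - by case: eqVneq => _ /=; ring.
      - by rewrite orbF; case: eqVneq => _ /=; ring.
      - by case: eqVneq => _ /=; ring.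
      - by ring.
    by rewrite -mulr_sumr sumrB big_split /= !delta.
  by ring.
transitivity (\sum_(k | I k) \sum_(i | I i) N%:R * (A k * B i * C k +
    (\sum_(j | I j) A k * B i * C j) * (k == i)%:R - A k * B i * C k * (k == i)%:R)).
  apply: eq_bigr => k Ik; apply: eq_bigr => i Ii.
  rewrite (eq_bigr _ (fun j Ij => inner k i j Ik Ii Ij)) -[LHS]mulr_sumr; congr (_ * _).
  by rewrite sumrB big_split /= -!mulr_suml !delta.
transitivity (\sum_(k | I k) N%:R * (class_sum 1 c^-1 * (A k * C k) +
    (A k * B k) * class_sum 1 y^-1 - A k * C k * B k)).
  apply: eq_bigr => k Ik; rewrite -mulr_sumr; congr (_ * _).
  rewrite sumrB big_split /= !delta // -mulr_sumr; congr (_ + _ - _); last by ring.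
  by rewrite mulr_suml; apply: eq_bigr => i _; rewrite /B; ring.
rewrite -mulr_sumr sumrB big_split /= -mulr_sumr -mulr_suml !class_sumM.
by congr (_ * (_ - _)); apply: eq_bigr => k _; rewrite chiM.
Qed.

Lemma three_points_complete :
  (forall k, (k < N)%N -> ceq 1 k -> c ^+ k = c -> k = 1%N) -> complete S.
Proof.
move=> cgen; pose E := class_sum 1.
have aE : ratio_adapted E := ratio_adapted_class_sum 1.
have aE1 : adapted S (fun p => E p.1^-1).
  move=> s p q sS ps qs; have := adapted_row a1 (adapted_swap cohS aE) sS ps qs.
  by rewrite /= !div1r.
have aEc : adapted S (fun p => E (p.1 / c)) := adapted_row ac aE.
have aW := adapted_mul cohS (adapted_comp2 *%R aE
  (adapted_swap cohS (adapted_comp2 *%R aEc aE1))) aE.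
(* [sidon_sum] is solved for its last term; the other terms are adapted because [a1] and [ac] allow
   fixing an argument at 1 or [c]. *)
have aQ : ratio_adapted (fun t => E (t / c)).
  have QE (p : F * F) : E (p.1 / p.2 / c) =
     E c^-1 * E (p.1 / p.2) + E (p.1 / c) * E p.2^-1 -
     N%:R^-1 * \sum_w E (p.1 / w) * (E (w / c) * E w^-1) * E (w / p.2).
    rewrite sidon_sum mulKf ?pnatr_eq0 ?gtn_eqF ?card_field_gt0 //.
    by rewrite opprB addrC subrK.
  move=> s p q sS ps qs; rewrite !QE (aE s p q) // (aEc s p q) //.
  by rewrite (adapted_swap cohS aE1 sS ps qs) (aW s p q).
(* These transforms agree on the class of 1, which yields [c ^+ k = c] for every [k] in it. *)
have hatQ k : (k < N)%N -> ceq 1 k ->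
    hat (fun t => E (t^-1 / c)) k = N%:R * chi g z k c^-1.
  move=> kN k1; rewrite /hat /E; under eq_bigr do rewrite class_sumM mulr_suml.
  rewrite exchange_big (bigD1 (Ordinal kN)) //=.
  rewrite [X in _ + X]big1 ?addr0 => [|j /andP[_ jk]].
    under eq_bigr do rewrite mulrAC [X in X * _]mulrC.
    by rewrite -mulr_suml sum_chi_mulV // eqxx.
  under eq_bigr do rewrite mulrAC [X in X * _]mulrC.
  rewrite -mulr_suml sum_chi_mulV // !modn_small //.
  case: eqP => [E'|_]; last by rewrite mul0r.
  by case/eqP: jk; apply: val_inj.
have uniq1 k : (k < N)%N -> ceq 1 k -> k = 1%N.
  move=> kN k1; apply: cgen => //.
  have := hat_ceq (ratio_adapted_inv aQ) k1.
  have N0 : N%:R != 0 :> algC by rewrite pnatr_eq0 gtn_eqF ?card_field_gt0.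
  rewrite !hatQ ?one_lt ?ceq_refl // => /(mulfI N0).
  by move/(chi_eq_expr gP zP (invr_neq0 c0)); rewrite expr1 exprVn => /invr_inj.
have EE t : E t = chi g z 1 t.
  rewrite /E /class_sum (bigD1 (Ordinal one_lt)) ?ceq_refl //= big1 ?addr0 //.
  move=> j /andP[j1 /eqP[]]; apply: val_inj => /=.
  by apply: uniq1; first exact: ltn_ord.
apply: (complete_of_injective cohS (chi_inj gP zP)).
move=> s p q sS ps qs; have := adapted_row a1 aE sS ps qs.
by rewrite /= !divr1 !EE.
Qed.
End ThreePoints.

(** * Antisymmetric cyclotomic schemes *)

Section Cyclotomic.
Variables (F : finFieldType) (K : {group {unit F}}).
Local Notation m := #|K|.
Local Notation N := #|F|.-1.

Lemma expr_card_mem_group (u : {unit F}) : u \in K -> val u ^+ m = 1.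
Proof.
move=> uK; have := expg_cardG uK => /(congr1 val).
by rewrite FinRing.val_unitX FinRing.val_unit1.
Qed.

(** An affine map with slope in [K] multiplies differences by an element whose [m]-th power is 1. *)
Lemma cyclotomic_fission_adapted S :
  fission (cyclotomic_scheme K) S -> adapted S (fun p => (p.1 - p.2) ^+ m).
Proof.
case/andP => cohS /forall_inP fS s p q sS ps qs.
have pK : affine_orbit K p \in cyclotomic_scheme K by apply: imset_f.
have pp : p \in affine_orbit K p.
  apply/imset2P; exists 1%g 0; rewrite ?group1 ?inE //.
  by rewrite FinRing.val_unit1 !mul1r !addr0 -surjective_pairing.
have /imset2P[a b aK _ ->] := subsetP (is_union_sub cohS (fS _ pK) sS ps pp) _ qs.
rewrite /= opprD addrACA subrr addr0 -mulrBr exprMn expr_card_mem_group //.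
by rewrite mul1r.
Qed.

Hypothesis asymK : cc_antisymmetric (cyclotomic_scheme K).

(** If -1 were in [K], the orbit of [(1, 0)] would be symmetric: slope [- a] and translation [a + b]
    produce the reverse of [(a + b, b)]. *)
Lemma antisymmetric_neqN1 u : u \in K -> val u != -1.
Proof.
move=> uK; apply/negP => /eqP u1.
have sK : affine_orbit K (1, 0) \in cyclotomic_scheme K by apply: imset_f.
have in_s a b : a \in K -> (val a + b, b) \in affine_orbit K (1, 0).
  by move=> aK; apply/imset2P; exists a b; rewrite ?inE //= mulr1 mulr0 add0r.
have sub p : p \in affine_orbit K (1, 0) -> (p.2, p.1) \in affine_orbit K (1, 0).
  case/imset2P => a b aK _ -> /=; rewrite mulr1 mulr0 add0r.
  have := in_s (u * a)%g (val a + b) (groupM uK aK).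
  by rewrite FinRing.val_unitM u1 mulN1r addKr.
have := forall_inP asymK _ sK; rewrite (_ : _ == _) /=; last first.
  apply/eqP/setP => p; rewrite inE; apply/idP/idP => /sub //=.
  by rewrite -surjective_pairing.
move/subsetP/(_ _ (in_s 1%g 0 (group1 K))); rewrite FinRing.val_unit1 inE /= addr0.
by rewrite oner_eq0.
Qed.

Lemma antisymmetric_two_neq0 : 2%:R != 0 :> F.
Proof.
apply: contra (antisymmetric_neqN1 (group1 K)) => /eqP F2.
by rewrite FinRing.val_unit1 -subr_eq0 opprK -mulr2n F2.
Qed.

Lemma antisymmetric_odd : odd m.
Proof.
apply: contraT; rewrite -dvdn2 => /(Cauchy (isT : prime 2))[u uK u2].
have := antisymmetric_neqN1 uK; have: val u ^+ 2 == 1.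
  by rewrite -FinRing.val_unitX -u2 expg_order FinRing.val_unit1.
rewrite sqrf_eq1 => /orP[/eqP u1|->] //.
by move: u2; rewrite (_ : u = 1%g) ?order1 //; apply: val_inj.
Qed.

Lemma antisymmetric_card : (2 * m <= N)%N.
Proof.
have mN : (m %| N)%N by rewrite -card_finField_unit cardSg ?subsetT.
case/dvdnP: mN => n NE; rewrite NE leq_mul2r; apply/orP; right.
have N0 := card_field_gt0 F.
rewrite ltn_neqAle; apply/andP; split; last first.
  by rewrite lt0n; apply: contraTneq N0; rewrite NE => ->.
apply: contraT => /negPn/eqP n1.
have u1 : (-1 : F) \is a GRing.unit by rewrite unitrN1.
have KT : K :=: [set: {unit F}].
  by apply/eqP; rewrite eqEcard subsetT card_finField_unit NE -n1 mul1n leqnn.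
have := @antisymmetric_neqN1 (FinRing.unit F u1).
by rewrite KT inE eqxx => /(_ isT).
Qed.

Lemma antisymmetric_natr_card : m%:R != 0 :> F.
Proof.
have [g gP] := finField_prim_root F.
have := natr_pred_card_neq0 gP; apply: contraNneq => m0.
have /dvdnP[n ->] : (m %| N)%N by rewrite -card_finField_unit cardSg ?subsetT.
by rewrite natrM m0 mulr0.
Qed.

(** For a primitive root [g], take [- g] if [g ^+ m = -1] and [g] otherwise. With [k] odd the sign
    cancels from [c ^+ k = c]. *)
Lemma exists_third_point : exists c : F, [/\ c != 0, c ^+ m != -1 &
  forall k, odd k -> (k < N)%N -> c ^+ k = c -> k = 1%N].
Proof.
have [g gP] := finField_prim_root F.
have N1 : (1 < N)%N.
  by apply: leq_trans antisymmetric_card; rewrite leq_pmulr // cardG_gt0.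
have g0 := primitive_root_neq0 gP.
have gk k : (k < N)%N -> g ^+ k = g -> k = 1%N.
  move=> kN /eqP; rewrite -[X in _ == X]expr1 (eq_prim_root_expr gP).
  by rewrite !modn_small // => /eqP.
have [gm|gm] := eqVneq (g ^+ m) (-1).
  exists (- g); split=> [||k k_odd kN].
  - by rewrite oppr_eq0.
  - rewrite exprNn -signr_odd antisymmetric_odd gm mulrNN mulr1 -subr_eq0 opprK.
    by rewrite -mulr2n antisymmetric_two_neq0.
  - by rewrite exprNn -signr_odd k_odd mulN1r => /oppr_inj; apply: gk.
by exists g; split=> // k _; apply: gk.
Qed.

(** * Separating the points of the set {0, 1, c} *)

Section Fission.
Variables (S : {set {set F * F}}) (c : F).
Hypothesis fS : fission (cyclotomic_scheme K) S.
Hypothesis c0 : c != 0.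
Hypothesis cm : c ^+ m != -1.

Let cohS : coherent S. Proof. by case/andP: fS. Qed.
Let aM := cyclotomic_fission_adapted fS.

Let oddM (x : F) : (- x) ^+ m = - x ^+ m.
Proof. by rewrite exprNn -signr_odd antisymmetric_odd mulN1r. Qed.

Lemma neq_opp (x : F) : x != 0 -> - x != x.
Proof.
move=> x0; rewrite -subr_eq0 -opprD oppr_eq0 -mulr2n -mulr_natl.
by rewrite mulf_neq0 // antisymmetric_two_neq0.
Qed.

(** As [m] is odd and 2 is nonzero, the two arcs between [a] and [b] have opposite nonzero colours,
    so only [a] starts an arc of colour [(b - a) ^+ m] inside the pair. *)
Lemma adapted_pair a b : a != b ->
  adapted S (fun p => (p.1 == a) || (p.1 == b)) -> adapted S (fun p => p.1 == a).
Proof.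
move=> ab aab.
have avm : adapted S (fun p : F * F => (p.2 - p.1) ^+ m == (b - a) ^+ m).
  move=> s p q sS ps qs; have /= -> // := adapted_swap cohS aM sS ps qs.
have a2 := adapted_comp2 andb aab
  (adapted_exists cohS (A := fun x => (x == a) || (x == b)) avm aab).
have ba0 : (b - a) ^+ m != 0 by rewrite expf_neq0 // subr_eq0 eq_sym.
have m0 : (0 < m)%N := cardG_gt0 K.
have E u : (u == a) = ((u == a) || (u == b)) &&
    [exists w, ((w - u) ^+ m == (b - a) ^+ m) && ((w == a) || (w == b))].
  have [->|ua] /= := eqVneq u a.
    by apply/esym/existsP; exists b; rewrite !eqxx orbT.
  have [->|//] /= := eqVneq u b.
  apply/esym/negbTE; rewrite negb_exists; apply/forallP => w.
  rewrite negb_and; case: (w =P a) => [->|_] /=; last first.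
    by case: (w =P b) => [->|_]; rewrite ?orbT // subrr expr0n gtn_eqF // eq_sym ba0.
  by rewrite -opprB oddM neq_opp.
by move=> s p q sS ps qs; rewrite [LHS]E [RHS]E; apply: a2 ps qs.
Qed.

Lemma adapted_three_points : adapted S (fun p => p.1 \in [set 0; 1; c]) ->
  [/\ adapted S (fun p => p.1 == 0), adapted S (fun p => p.1 == 1) &
      adapted S (fun p => p.1 == c)].
Proof.
move=> aD; have m0 : (0 < m)%N := cardG_gt0 K.
have aK : adapted S (fun p : F * F => (p.1 - p.2) ^+ m == 1).
  by move=> s p q sS ps qs; rewrite (aM sS ps qs).
(* [A] selects the points of the set with no difference of colour 1 to another one: 0 always, by
   [cm], never 1, and possibly [c]. [adapted_pair] then splits what remains. *)
pose A u := (u \in [set 0; 1; c]) &&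
  ~~ [exists w, ((u - w) ^+ m == 1) && (w \in [set 0; 1; c])].
have aA : adapted S (fun p => A p.1).
  have aE := adapted_exists cohS (A := fun x => x \in [set 0; 1; c]) aK aD.
  by move=> s p q sS ps qs; have /= E := aE s p q sS ps qs; rewrite /A E (aD s p q).
have A0 : A 0.
  rewrite /A !inE eqxx negb_exists; apply/forallP => w; rewrite negb_and sub0r oddM.
  rewrite orbC -implybE !inE -orbA; apply/implyP => /or3P[] /eqP->.
  - by rewrite expr0n gtn_eqF // oppr0 eq_sym oner_eq0.
  - by rewrite expr1n neq_opp ?oner_eq0.
  - by rewrite eqr_oppLR.
have A1 : ~~ A 1.
  rewrite negb_and negbK; apply/orP; right; apply/existsP; exists 0.
  by rewrite subr0 expr1n !inE !eqxx.
have a0 : adapted S (fun p => p.1 == 0).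
  have AE u : A u = (u == 0) || (u == c) && A c.
    have [->|u0] := eqVneq u 0; first by rewrite A0.
    have [->|uc] := eqVneq u c; first by [].
    have [->|u1] := eqVneq u 1; first exact/negbTE.
    by rewrite /A !inE (negPf u0) (negPf uc) (negPf u1).
  have [Ac|Ac] := boolP (A c).
    apply: (@adapted_pair 0 c); first by rewrite eq_sym.
    move=> s p q sS ps qs; have := aA s p q sS ps qs.
    by rewrite (AE p.1) (AE q.1) Ac !andbT.
  move=> s p q sS ps qs; have := aA s p q sS ps qs.
  by rewrite (AE p.1) (AE q.1) (negPf Ac) !andbF !orbF.
have a1c : adapted S (fun p => (p.1 == 1) || (p.1 == c)).
  have E u : (u == 1) || (u == c) = (u \in [set 0; 1; c]) && (u != 0).
    rewrite !inE; have [->|u0] /= := eqVneq u 0; last by rewrite andbT.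
    by rewrite eq_sym oner_eq0 eq_sym (negPf c0).
  by move=> s p q sS ps qs; rewrite !E (aD s p q) // (a0 s p q).
(* This case occurs over the field with three elements, where -1 is the primitive root and the
   chosen point is 1. *)
have [c1|c1] := eqVneq c 1.
  by split=> // s p q sS ps qs; have := a1c s p q sS ps qs; rewrite c1 !orbb.
split=> //; first by apply: adapted_pair a1c; rewrite eq_sym.
apply: (adapted_pair c1) => s p q sS ps qs.
by rewrite orbC (a1c s p q) // orbC.
Qed.

(** Exponents equivalent to 1 are powers of the odd characteristic, hence odd, which is what the
    condition on [c] demands. *)
Lemma cyclotomic_three_points_complete :
  (forall k, odd k -> (k < N)%N -> c ^+ k = c -> k = 1%N) ->
  adapted S (fun p => p.1 == 0) -> adapted S (fun p => p.1 == 1) ->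
  adapted S (fun p => p.1 == c) -> complete S.
Proof.
move=> cgen a0 a1 ac; have [g gP] := finField_prim_root F.
have [z zP] := C_prim_root_exists (card_field_gt0 F).
have F2 := antisymmetric_two_neq0.
apply: (three_points_complete cohS gP zP a0 antisymmetric_card
  antisymmetric_natr_card aM a1 ac F2 c0) => k kN k1; apply: cgen => //.
have [p p_pr pF] := finPcharP F.
have [l ->] := ceq1_expn cohS gP zP a0 antisymmetric_card
  antisymmetric_natr_card aM pF kN k1.
rewrite oddX; case: (even_prime p_pr) => [p2|->]; last by rewrite orbT.
by case/negP: F2; rewrite -p2 pcharf0.
Qed.
End Fission.
End Cyclotomic.

Local Close Scope ring_scope.

Theorem theorem3p2 (F : finFieldType) (K : {group {unit F}}) :
  cc_antisymmetric (cyclotomic_scheme K) ->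
  gb (cyclotomic_scheme K) <= 1 /\ bnum (cyclotomic_scheme K) <= 3.
Proof.
move=> asymK; have [c [c0 cm cgen]] := exists_third_point asymK.
split.
- rewrite -(cards1 ([set 0; 1; c] : {set F})%R); apply: bigmin_leq.
  apply: gen_baseI => S fS /(_ _ (set11 _)) uD.
  have cohS : coherent S by case/andP: fS.
  have [a0 a1 ac] := adapted_three_points asymK fS c0 cm
    (adapted_union_of_fibers cohS uD).
  exact: (cyclotomic_three_points_complete asymK fS c0).
(* Only an upper bound, since [c = 1] is possible. *)
- have B3 : #|([set 0; 1; c] : {set F})%R| <= 3.
    by rewrite -setUA !cardsU1 cards1; do 2!case: (_ \notin _).
  apply: leq_trans B3; apply: bigmin_leq; apply: gen_baseI => S fS uB.
  have cohS : coherent S by case/andP: fS.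
  have aB x : x \in ([set 0; 1; c] : {set F})%R -> adapted S (fun p => p.1 == x).
    move=> xB s p q sS ps qs.
    have := adapted_union_of_fibers cohS (uB [set x] (imset_f _ xB)) sS ps qs.
    by rewrite !inE.
  by apply: (cyclotomic_three_points_complete asymK fS c0) => //; apply: aB;
    rewrite !inE eqxx ?orbT.
Qed.
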